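(* Let $\mathcal P$ be a set of formulas. If $\Gamma\vdash_{\mathcal P}\Delta;\Pi$, then the two-sided linear logic sequent $t(\Gamma)\vdash ?t(\Delta),t(\Pi)$ is derivable in $\mathrm{LL}$, where for a multiset $\Gamma=A_1,\dots,A_n$ one writes $t(\Gamma)=t(A_1),\dots,t(A_n)$ and $?t(\Delta)$ denotes $?t(D_1),\dots,?t(D_m)$ for $\Delta=D_1,\dots,D_m$.
   Context: Formulas are given by the grammar $F ::= 0 \mid \perp \mid X \mid F\wedge F \mid F\vee F \mid F\rightarrow F$, where $X$ ranges over a set $\mathcal V$ of propositional variables and $0$, $\perp$ are two distinct constants. $\mathrm{LL}$ is (propositional, two-sided) Girard linear logic, with the elements of $\mathcal V$ used as atoms. The translations $b,t$ from formulas to LL formulas are defined by mutual recursion: $b(A)=t(A)$ if $A\notin\mathcal P$ and $b(A)=?t(A)$ if $A\in\mathcal P$; $t(0)=t(\perp)=0$ (the additive zero of LL); $t(X)=!X$ for $X\in\mathcal V$; $t(A\wedge B)=!b(A)\otimes !b(B)$; $t(A\vee B)=!b(A)\oplus !b(B)$; $t(A\rightarrow B)=!(t(A)\multimap b(B))$. Fix a set $\mathcal P$ of formulas. A $\mathcal P$-sequent is an expression $\Gamma\vdash\Delta;\Pi$ where $\Gamma,\Delta,\Pi$ are finite multisets of formulas, every formula of $\Delta$ (the body) belongs to $\mathcal P$, and $\Pi$ (the stoup) contains at most one formula. The system $\mathrm{ML}_{\mathcal P}$ derives $\mathcal P$-sequents with the following rules (below $C$ denotes a single formula, $\Pi$ a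 stoup with at most one formula, and all sequents must be $\mathcal P$-sequents): Axiom/cuts: $ax$: $A\vdash ;A$. $cut_1$: from $\Gamma\vdash\Delta;A$ and $\Gamma',A\vdash\Delta';\Pi$ infer $\Gamma,\Gamma'\vdash\Delta,\Delta';\Pi$. $cut_2$: from $\Gamma\vdash\Delta,A;\Pi$ and $\Gamma',A\vdash\Delta';$ infer $\Gamma,\Gamma'\vdash\Delta,\Delta';\Pi$. Structure: $der$: from $\Gamma\vdash\Delta;A$ with $A\in\mathcal P$ infer $\Gamma\vdash\Delta,A;$. $c_l$: from $\Gamma,A,A\vdash\Delta;\Pi$ infer $\Gamma,A\vdash\Delta;\Pi$. $c_r$: from $\Gamma\vdash\Delta,A,A;\Pi$ infer $\Gamma\vdash\Delta,A;\Pi$. $w_l$: from $\Gamma\vdash\Delta;\Pi$ infer $\Gamma,A\vdash\Delta;\Pi$. $w_r$: from $\Gamma\vdash\Delta;\Pi$ with $A\in\mathcal P$ infer $\Gamma\vdash\Delta,A;\Pi$. Logic: $0$: $\Gamma,0\vdash\Delta;\Pi$ (any $\Delta\subseteq\mathcal P$). $\perp$: $\perp\vdash ;$. $\wedge^1_l$: from $\Gamma,A,B\vdash\Delta;C$ with $A\notin\mathcal P$ and $B\notin\mathcal P$ infer $\Gamma,A\wedge B\vdash\Delta;C$. $\wedge^2_l$: from $\Gamma,A,B\vdash\Delta;$ infer $\Gamma,A\wedge B\vdash\Delta;$. $\wedge^1_r$: from $\Gamma\vdash\Delta;A$ and $\Gamma'\vdash\Delta';B$ infer $\Gamma,\Gamma'\vdash\Delta,\Delta';A\wedge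 B$. $\wedge^2_r$: from $\Gamma\vdash\Delta,A;$ and $\Gamma'\vdash\Delta',B;$ infer the same conclusion. $\wedge^3_r$: from $\Gamma\vdash\Delta;A$ and $\Gamma'\vdash\Delta',B;$ infer the same conclusion. $\wedge^4_r$: from $\Gamma\vdash\Delta,A;$ and $\Gamma'\vdash\Delta';B$ infer the same conclusion. $\vee^1_l$: from $\Gamma,A\vdash\Delta;C$ and $\Gamma,B\vdash\Delta;C$ with $A\notin\mathcal P$ and $B\notin\mathcal P$ infer $\Gamma,A\vee B\vdash\Delta;C$. $\vee^2_l$: from $\Gamma,A\vdash\Delta;$ and $\Gamma,B\vdash\Delta;$ infer $\Gamma,A\vee B\vdash\Delta;$. $\vee^1_r$: from $\Gamma\vdash\Delta;A$ infer $\Gamma\vdash\Delta;A\vee B$. $\vee^2_r$: from $\Gamma\vdash\Delta;B$ infer $\Gamma\vdash\Delta;A\vee B$. $\vee^3_r$: from $\Gamma\vdash\Delta,A;$ infer $\Gamma\vdash\Delta;A\vee B$. $\vee^4_r$: from $\Gamma\vdash\Delta,B;$ infer $\Gamma\vdash\Delta;A\vee B$. $\rightarrow^1_l$: from $\Gamma,B\vdash\Delta;C$ and $\Gamma'\vdash\Delta';A$ with $B\notin\mathcal P$ infer $\Gamma,\Gamma',A\rightarrow B\vdash\Delta,\Delta';C$. $\rightarrow^2_l$: from $\Gamma,B\vdash\Delta;$ and $\Gamma'\vdash\Delta';A$ infer $\Gamma,\Gamma',A\rightarrow B\vdash\Delta,\Delta';$. $\rightarrow^3_l$: from $\Gamma,B\vdash\Delta;$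 and $\Gamma'\vdash\Delta',A;\Pi$ infer $\Gamma,\Gamma',A\rightarrow B\vdash\Delta,\Delta';\Pi$. $\rightarrow^1_r$: from $\Gamma,A\vdash\Delta;B$ infer $\Gamma\vdash\Delta;A\rightarrow B$. $\rightarrow^2_r$: from $\Gamma,A\vdash\Delta,B;$ infer $\Gamma\vdash\Delta;A\rightarrow B$. One writes $\Gamma\vdash_{\mathcal P}\Delta;\Pi$ when the $\mathcal P$-sequent $\Gamma\vdash\Delta;\Pi$ is derivable in $\mathrm{ML}_{\mathcal P}$. *)

(* Defs.v *)
From Stdlib Require Import List Permutation ClassicalEpsilon.
Import ListNotations.
Set Implicit Arguments.

(* A set of formulas is a predicate [formula V -> Prop].  Finite multisets are
   lists, with explicit exchange rules in both calculi. *)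

Inductive formula (V : Type) : Type :=
| FZero
| FBot
| FVar (X : V)
| FAnd (A B : formula V)
| FOr (A B : formula V)
| FImp (A B : formula V).

Arguments FZero {V}.
Arguments FBot {V}.

Inductive llform (V : Type) : Type :=
| LAtom (X : V)
| LOne
| LBot
| LTop
| LZero
| LNeg (A : llform V)
| LTensor (A B : llform V)
| LPar (A B : llform V)
| LWith (A B : llform V)
| LPlus (A B : llform V)
| LLimp (A B : llform V)
| LBang (A : llform V)
| LWhyNot (A : llform V).

Arguments LOne {V}.
Arguments LBot {V}.
Arguments LTop {V}.
Arguments LZero {V}.

Inductive LL (V : Type) : list (llform V) -> list (llform V) -> Prop :=
| ll_ax A : LL [A] [A]
| ll_cut G G' D D' A :
    LL G (A :: D) -> LL (A :: G') D' -> LL (G ++ G') (D ++ D')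
| ll_exch_l G G' D : Permutation G G' -> LL G D -> LL G' D
| ll_exch_r G D D' : Permutation D D' -> LL G D -> LL G D'
| ll_neg_l G D A : LL G (A :: D) -> LL (LNeg A :: G) D
| ll_neg_r G D A : LL (A :: G) D -> LL G (LNeg A :: D)
| ll_one_l G D : LL G D -> LL (LOne :: G) D
| ll_one_r : LL [] [LOne]
| ll_bot_l : LL [LBot] []
| ll_bot_r G D : LL G D -> LL G (LBot :: D)
| ll_top_r G D : LL G (LTop :: D)
| ll_zero_l G D : LL (LZero :: G) D
| ll_tensor_l G D A B : LL (A :: B :: G) D -> LL (LTensor A B :: G) D
| ll_tensor_r G G' D D' A B :
    LL G (A :: D) -> LL G' (B :: D') ->
    LL (G ++ G') (LTensor A B :: D ++ D')
| ll_par_l G G' D D' A B :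
    LL (A :: G) D -> LL (B :: G') D' ->
    LL (LPar A B :: G ++ G') (D ++ D')
| ll_par_r G D A B : LL G (A :: B :: D) -> LL G (LPar A B :: D)
| ll_with_l1 G D A B : LL (A :: G) D -> LL (LWith A B :: G) D
| ll_with_l2 G D A B : LL (B :: G) D -> LL (LWith A B :: G) D
| ll_with_r G D A B :
    LL G (A :: D) -> LL G (B :: D) -> LL G (LWith A B :: D)
| ll_plus_l G D A B :
    LL (A :: G) D -> LL (B :: G) D -> LL (LPlus A B :: G) D
| ll_plus_r1 G D A B : LL G (A :: D) -> LL G (LPlus A B :: D)
| ll_plus_r2 G D A B : LL G (B :: D) -> LL G (LPlus A B :: D)
| ll_limp_l G G' D D' A B :
    LL G (A :: D) -> LL (B :: G') D' ->
    LL (LLimp A B :: G ++ G') (D ++ D')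
| ll_limp_r G D A B : LL (A :: G) (B :: D) -> LL G (LLimp A B :: D)
| ll_bang_d G D A : LL (A :: G) D -> LL (LBang A :: G) D
| ll_bang_w G D A : LL G D -> LL (LBang A :: G) D
| ll_bang_c G D A : LL (LBang A :: LBang A :: G) D -> LL (LBang A :: G) D
| ll_bang_p G D A :
    LL (map (@LBang V) G) (A :: map (@LWhyNot V) D) ->
    LL (map (@LBang V) G) (LBang A :: map (@LWhyNot V) D)
| ll_whynot_d G D A : LL G (A :: D) -> LL G (LWhyNot A :: D)
| ll_whynot_w G D A : LL G D -> LL G (LWhyNot A :: D)
| ll_whynot_c G D A :
    LL G (LWhyNot A :: LWhyNot A :: D) -> LL G (LWhyNot A :: D)
| ll_whynot_p G D A :
    LL (A :: map (@LBang V) G) (map (@LWhyNot V) D) ->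
    LL (LWhyNot A :: map (@LBang V) G) (map (@LWhyNot V) D).

(* [trb P A (trt P A)] is [b(A)]: taking [t(A)] as an argument makes the mutual
   recursion of [b] and [t] structural. *)
Definition trb (V : Type) (P : formula V -> Prop) (A : formula V)
    (tA : llform V) : llform V :=
  if excluded_middle_informative (P A) then LWhyNot tA else tA.

Fixpoint trt (V : Type) (P : formula V -> Prop) (A : formula V) : llform V :=
  match A with
  | FZero => LZero
  | FBot => LZero
  | FVar X => LBang (LAtom X)
  | FAnd A B =>
      LTensor (LBang (trb P A (trt P A))) (LBang (trb P B (trt P B)))
  | FOr A B =>
      LPlus (LBang (trb P A (trt P A))) (LBang (trb P B (trt P B)))
  | FImp A B => LBang (LLimp (trt P A) (trb P B (trt P B)))
  end.

(* [ML P G D S] is derivability of [G |- D ; S].  The requirement that the body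
   consist of formulas of [P] needs a side condition only in [ml_der], [ml_w_r]
   and [ml_zero]; see [ML_body]. *)
Inductive ML (V : Type) (P : formula V -> Prop) :
    list (formula V) -> list (formula V) -> option (formula V) -> Prop :=
| ml_ax A : ML P [A] [] (Some A)
| ml_cut1 G G' D D' S A :
    ML P G D (Some A) -> ML P (A :: G') D' S -> ML P (G ++ G') (D ++ D') S
| ml_cut2 G G' D D' S A :
    ML P G (A :: D) S -> ML P (A :: G') D' None -> ML P (G ++ G') (D ++ D') S
| ml_exch_l G G' D S : Permutation G G' -> ML P G D S -> ML P G' D S
| ml_exch_r G D D' S : Permutation D D' -> ML P G D S -> ML P G D' S
| ml_der G D A : P A -> ML P G D (Some A) -> ML P G (A :: D) None
| ml_c_l G D S A : ML P (A :: A :: G) D S -> ML P (A :: G) D S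
| ml_c_r G D S A : ML P G (A :: A :: D) S -> ML P G (A :: D) S
| ml_w_l G D S A : ML P G D S -> ML P (A :: G) D S
| ml_w_r G D S A : P A -> ML P G D S -> ML P G (A :: D) S
| ml_zero G D S : Forall P D -> ML P (FZero :: G) D S
| ml_bot : ML P [FBot] [] None
| ml_and_l1 G D A B C :
    ~ P A -> ~ P B ->
    ML P (A :: B :: G) D (Some C) -> ML P (FAnd A B :: G) D (Some C)
| ml_and_l2 G D A B :
    ML P (A :: B :: G) D None -> ML P (FAnd A B :: G) D None
| ml_and_r1 G G' D D' A B :
    ML P G D (Some A) -> ML P G' D' (Some B) ->
    ML P (G ++ G') (D ++ D') (Some (FAnd A B))
| ml_and_r2 G G' D D' A B :
    ML P G (A :: D) None -> ML P G' (B :: D') None ->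
    ML P (G ++ G') (D ++ D') (Some (FAnd A B))
| ml_and_r3 G G' D D' A B :
    ML P G D (Some A) -> ML P G' (B :: D') None ->
    ML P (G ++ G') (D ++ D') (Some (FAnd A B))
| ml_and_r4 G G' D D' A B :
    ML P G (A :: D) None -> ML P G' D' (Some B) ->
    ML P (G ++ G') (D ++ D') (Some (FAnd A B))
| ml_or_l1 G D A B C :
    ~ P A -> ~ P B ->
    ML P (A :: G) D (Some C) -> ML P (B :: G) D (Some C) ->
    ML P (FOr A B :: G) D (Some C)
| ml_or_l2 G D A B :
    ML P (A :: G) D None -> ML P (B :: G) D None ->
    ML P (FOr A B :: G) D None
| ml_or_r1 G D A B : ML P G D (Some A) -> ML P G D (Some (FOr A B))
| ml_or_r2 G D A B : ML P G D (Some B) -> ML P G D (Some (FOr A B))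
| ml_or_r3 G D A B : ML P G (A :: D) None -> ML P G D (Some (FOr A B))
| ml_or_r4 G D A B : ML P G (B :: D) None -> ML P G D (Some (FOr A B))
| ml_imp_l1 G G' D D' A B C :
    ~ P B ->
    ML P (B :: G) D (Some C) -> ML P G' D' (Some A) ->
    ML P (FImp A B :: G ++ G') (D ++ D') (Some C)
| ml_imp_l2 G G' D D' A B :
    ML P (B :: G) D None -> ML P G' D' (Some A) ->
    ML P (FImp A B :: G ++ G') (D ++ D') None
| ml_imp_l3 G G' D D' S A B :
    ML P (B :: G) D None -> ML P G' (A :: D') S ->
    ML P (FImp A B :: G ++ G') (D ++ D') S
| ml_imp_r1 G D A B :
    ML P (A :: G) D (Some B) -> ML P G D (Some (FImp A B))
| ml_imp_r2 G D A B :
    ML P (A :: G) (B :: D) None -> ML P G D (Some (FImp A B)).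

Lemma ML_body (V : Type) (P : formula V -> Prop) G D S :
  ML P G D S -> Forall P D.
Proof.
  induction 1;
    repeat match goal with
      | H : Forall P (_ :: _) |- _ => inversion H; clear H; subst
      end;
    try (apply Forall_app; split);
    auto using Forall_nil, Forall_cons.
  eapply Permutation_Forall; eassumption.
Qed.

Definition stoup_list (T : Type) (S : option T) : list T :=
  match S with Some A => [A] | None => [] end.

(* Main.v *)
(** Every [t(A)] entails [!t(A)], so formulas [t(A)] on the left behave like
    banged ones: they can be contracted and weakened, and they are admissible as
    the context of a promotion.  Hence a [?t(A)] produced by the body can be cut
    against a premise with empty stoup, which is what the rules of ML that act
    on body formulas require. *)

Require Import Defs.
From Stdlib Require Import List.
From Stdlib Require Import Permutation ClassicalEpsilon.
Import ListNotations.

(* Rotates the right list until its first block matches that of the left list;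
   diverges if no block matches syntactically. *)
Ltac perm_blocks :=
  cbn [map app stoup_list];
  repeat rewrite ?map_app, <- ?app_assoc, ?app_nil_r, <- ?app_comm_cons;
  try reflexivity;
  match goal with
  | |- Permutation (?a :: _) (?a :: _) => apply perm_skip; perm_blocks
  | |- Permutation (?a ++ _) (?a ++ _) => apply Permutation_app_head; perm_blocks
  | |- Permutation _ (?b :: ?c) =>
      transitivity (c ++ [b]); [perm_blocks | symmetry; apply Permutation_cons_append]
  | |- Permutation _ (?b ++ ?c) =>
      transitivity (c ++ b); [perm_blocks | apply Permutation_app_comm]
  end.

Section LinearLogic.
Context {V : Type}.
Implicit Types (A B : llform V) (G D H : list (llform V)).

Notation whynots := (map (@LWhyNot V)).

Lemma ll_exch G G' D D' :
  LL G D -> Permutation G G' -> Permutation D D' -> LL G' D'.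
Proof. eauto using ll_exch_l, ll_exch_r. Qed.

(** With dereliction this makes [A] and [!A] interderivable, so one cut transfers the left
    structural rules of [!A] to [A]. *)
Definition bangable A : Prop := LL [A] [LBang A].

Lemma bangable_bang A : bangable (LBang A).
Proof. apply (ll_bang_p [A] []), ll_ax. Qed.

Lemma bangable_zero : bangable LZero.
Proof. apply ll_zero_l. Qed.

(** Decomposing the tensor first exposes the context [!A, !B], over which promotion is allowed. *)
Lemma bangable_tensor A B : bangable (LTensor (LBang A) (LBang B)).
Proof.
  apply ll_tensor_l, (ll_bang_p [A; B] []).
  apply (@ll_tensor_r _ [LBang A] [LBang B] [] []); apply ll_ax.
Qed.

Lemma bangable_plus A B : bangable (LPlus (LBang A) (LBang B)).
Proof.
  apply ll_plus_l.
  - apply (ll_bang_p [A] []), ll_plus_r1, ll_ax.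
  - apply (ll_bang_p [B] []), ll_plus_r2, ll_ax.
Qed.

Lemma bangable_cut A G D : bangable A -> LL (LBang A :: G) D -> LL (A :: G) D.
Proof. intros HA HG. exact (ll_cut HA HG). Qed.

Lemma ll_weak_l A G D : bangable A -> LL G D -> LL (A :: G) D.
Proof. auto using bangable_cut, ll_bang_w. Qed.

Lemma ll_contr_l A G D : bangable A -> LL (A :: A :: G) D -> LL (A :: G) D.
Proof.
  intros HA HG. apply bangable_cut, ll_bang_c, ll_bang_d; trivial.
  apply ll_exch_l with (LBang A :: A :: G); [apply perm_swap|].
  now apply ll_bang_d.
Qed.

(** [H] is general because the induction moves each treated formula into it. *)
Lemma ll_der_context G H D : LL (G ++ H) D -> LL (map (@LBang V) G ++ H) D.
Proof.
  revert H. induction G as [|A G IH]; intros H HG; trivial.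
  cbn. apply ll_bang_d.
  apply ll_exch with (map (@LBang V) G ++ A :: H) D; [|perm_blocks..].
  apply IH. eapply ll_exch; [exact HG|perm_blocks..].
Qed.

Lemma ll_unbang_context G H D :
  Forall bangable G -> LL (map (@LBang V) G ++ H) D -> LL (G ++ H) D.
Proof.
  intros HG. revert H. induction HG as [|A G HA HG IH]; intros H HD; trivial.
  cbn. apply bangable_cut; trivial.
  apply ll_exch with (G ++ LBang A :: H) D; [|perm_blocks..].
  apply IH. eapply ll_exch; [exact HD|perm_blocks..].
Qed.

(** Derelicting the whole context gives the banged context that promotion demands; cuts then remove
    the bangs again. *)
Lemma ll_promote_r G D A :
  Forall bangable G ->
  LL G (A :: whynots D) -> LL G (LBang A :: whynots D).
Proof.
  intros HG HA. rewrite <- (app_nil_r G). apply ll_unbang_context; trivial.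
  rewrite app_nil_r. apply ll_bang_p.
  rewrite <- (app_nil_r (map _ G)). apply ll_der_context.
  now rewrite app_nil_r.
Qed.

(** The right side must consist of [?]-formulas, which is what a translated sequent with empty stoup
    provides. *)
Lemma ll_promote_l G D A :
  Forall bangable G ->
  LL (A :: G) (whynots D) -> LL (LWhyNot A :: G) (whynots D).
Proof.
  intros HG HA.
  apply ll_exch with (G ++ [LWhyNot A]) (whynots D); [|perm_blocks..].
  apply ll_unbang_context; trivial.
  apply ll_exch with (LWhyNot A :: map (@LBang V) G) (whynots D);
    [|perm_blocks..].
  apply ll_whynot_p.
  apply ll_exch with (map (@LBang V) G ++ [A]) (whynots D); [|perm_blocks..].
  apply ll_der_context.
  eapply ll_exch; [exact HA|perm_blocks..].
Qed.

End LinearLogic.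

Section Translation.
Context {V : Type} (P : formula V -> Prop).

Notation t := (trt P).
Notation b A := (trb P A (trt P A)).
Notation whynots D := (map (@LWhyNot V) D).

Lemma trb_in A : P A -> b A = LWhyNot (t A).
Proof. unfold trb. now destruct excluded_middle_informative. Qed.

Lemma trb_notin A : ~ P A -> b A = t A.
Proof. unfold trb. now destruct excluded_middle_informative. Qed.

Lemma bangable_trt A : bangable (t A).
Proof.
  destruct A; cbn;
    auto using bangable_zero, bangable_bang, bangable_tensor, bangable_plus.
Qed.

Lemma bangable_map_trt Gamma : Forall bangable (map t Gamma).
Proof. induction Gamma; cbn; auto using bangable_trt. Qed.

Lemma trb_l A G D :
  Forall bangable G -> LL (t A :: G) (whynots D) -> LL (b A :: G) (whynots D).
Proof.
  intros HG HA. destruct (excluded_middle_informative (P A)) as [HP|HP].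
  - rewrite trb_in by assumption. now apply ll_promote_l.
  - now rewrite trb_notin.
Qed.

Lemma trb_r A G D : LL G (t A :: D) -> LL G (b A :: D).
Proof.
  intros HA. destruct (excluded_middle_informative (P A)) as [HP|HP].
  - rewrite trb_in by assumption. now apply ll_whynot_d.
  - now rewrite trb_notin.
Qed.

(** From the stoup, [t(A)] becomes [b(A)] by dereliction if [A] is in [P] and equals it otherwise;
    promotion then adds the bang. *)
Lemma ll_bang_trb_stoup A Gamma D :
  LL (map t Gamma) (t A :: whynots D) ->
  LL (map t Gamma) (LBang (b A) :: whynots D).
Proof. auto using ll_promote_r, trb_r, bangable_map_trt. Qed.

Lemma ll_bang_trb_body A Gamma D :
  P A -> LL (map t Gamma) (LWhyNot (t A) :: whynots D) ->
  LL (map t Gamma) (LBang (b A) :: whynots D).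
Proof.
  intros HP HA. rewrite trb_in by assumption.
  auto using ll_promote_r, bangable_map_trt.
Qed.

(** The logical rules that consume a body formula state no membership in [P]; it is recovered here
    to identify [b(A)] with [?t(A)]. *)
Lemma ML_body_head A Gamma Delta Pi : ML P Gamma (A :: Delta) Pi -> P A.
Proof. intros HML. exact (Forall_inv (ML_body HML)). Qed.

Lemma ll_tensor_trt_r A B Gamma Gamma' Delta Delta' :
  LL (map t Gamma) (LBang (b A) :: whynots (map t Delta)) ->
  LL (map t Gamma') (LBang (b B) :: whynots (map t Delta')) ->
  LL (map t (Gamma ++ Gamma'))
     (t (FAnd A B) :: whynots (map t (Delta ++ Delta'))).
Proof. intros HA HB. rewrite !map_app. now apply ll_tensor_r. Qed.

(* The stoup is placed first so that it is the principal position of the right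
   rules of LL. *)
Lemma ML_to_LL Gamma Delta Pi :
  ML P Gamma Delta Pi ->
  LL (map t Gamma) (map t (stoup_list Pi) ++ whynots (map t Delta)).
Proof.
  induction 1; cbn [map app stoup_list] in *.
  - apply ll_ax.
  - eapply ll_exch; [exact (ll_cut IHML1 IHML2)|perm_blocks..].
  (* The second premise has an empty stoup, so its [t(A)] promotes to [?t(A)] and can be cut against
     the body formula. *)
  - apply ll_promote_l in IHML2; [|apply bangable_map_trt].
    eapply ll_exch.
    + eapply ll_cut; [|exact IHML2].
      eapply ll_exch_r; [|exact IHML1]. symmetry. apply Permutation_middle.
    + perm_blocks.
    + perm_blocks.
  - eapply ll_exch_l; [|exact IHML]. now apply Permutation_map.
  - eapply ll_exch_r; [|exact IHML].
    now apply Permutation_app_head, Permutation_map, Permutation_map.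
  - now apply ll_whynot_d.
  - apply ll_contr_l; trivial. apply bangable_trt.
  - eapply ll_exch_r; [apply Permutation_middle|].
    apply ll_whynot_c. eapply ll_exch; [exact IHML|perm_blocks..].
  - apply ll_weak_l; trivial. apply bangable_trt.
  - eapply ll_exch_r; [apply Permutation_middle|]. now apply ll_whynot_w.
  - apply ll_zero_l.
  - apply ll_zero_l.
  (* An occupied stoup blocks left promotion of [?]; outside [P], though, [b] is [t] and dereliction
     suffices. *)
  - cbn [trt]. rewrite !trb_notin by assumption.
    apply ll_tensor_l, ll_bang_d. eapply ll_exch_l; [apply perm_swap|].
    apply ll_bang_d. now eapply ll_exch_l; [apply perm_swap|].
  (* [b(A)] is reduced to [t(A)] while the other conjunct is still banged, so that the whole context
     is bangable. *)
  - apply ll_tensor_l, ll_bang_d, trb_l.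
    { auto using bangable_bang, bangable_map_trt. }
    eapply ll_exch_l; [apply perm_swap|].
    apply ll_bang_d, trb_l.
    { auto using bangable_trt, bangable_map_trt. }
    now eapply ll_exch_l; [apply perm_swap|].
  - apply ll_tensor_trt_r; now apply ll_bang_trb_stoup.
  - apply ll_tensor_trt_r; apply ll_bang_trb_body; trivial;
      eauto using ML_body_head.
  - apply ll_tensor_trt_r; [now apply ll_bang_trb_stoup|].
    apply ll_bang_trb_body; eauto using ML_body_head.
  - apply ll_tensor_trt_r; [|now apply ll_bang_trb_stoup].
    apply ll_bang_trb_body; eauto using ML_body_head.
  - cbn [trt]. rewrite !trb_notin by assumption.
    now apply ll_plus_l; apply ll_bang_d.
  - apply ll_plus_l; apply ll_bang_d, trb_l; auto using bangable_map_trt.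
  - now apply ll_plus_r1, ll_bang_trb_stoup.
  - now apply ll_plus_r2, ll_bang_trb_stoup.
  - apply ll_plus_r1, ll_bang_trb_body; eauto using ML_body_head.
  - apply ll_plus_r2, ll_bang_trb_body; eauto using ML_body_head.
  - cbn [trt]. rewrite trb_notin by assumption. apply ll_bang_d.
    eapply ll_exch; [exact (ll_limp_l IHML2 IHML1)|perm_blocks..].
  - apply trb_l in IHML1; [|apply bangable_map_trt].
    cbn [trt]. apply ll_bang_d.
    eapply ll_exch; [exact (ll_limp_l IHML2 IHML1)|perm_blocks..].
  - apply trb_l in IHML1; [|apply bangable_map_trt].
    (* The stoup belongs to the other premise. A sequent without it is built from an axiom on
       [t(A)]; its right side is all [?], so [t(A)] promotes to [?t(A)], and a cut then brings in
       the stoup. *)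
    assert (HA : LL (LWhyNot (t A) :: t (FImp A B) :: map t G)
                    (whynots (map t D))).
    { apply ll_promote_l.
      { constructor; auto using bangable_trt, bangable_map_trt. }
      eapply ll_exch_l; [apply perm_swap|]. apply ll_bang_d.
      exact (ll_limp_l (ll_ax (t A)) IHML1). }
    eapply ll_exch.
    + eapply ll_cut; [|exact HA].
      eapply ll_exch_r; [|exact IHML2]. symmetry. apply Permutation_middle.
    + perm_blocks.
    + perm_blocks.
  (* The outer bang of [t(A -> B)] comes from promotion: the left is bangable and, besides the
     principal formula, the right is all [?]. *)
  - apply ll_promote_r; [apply bangable_map_trt|]. now apply ll_limp_r, trb_r.
  - apply ll_promote_r; [apply bangable_map_trt|]. apply ll_limp_r.
    rewrite trb_in; [assumption|]. eauto using ML_body_head.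
Qed.

End Translation.

Theorem theorem5p3 (V : Type) (P : formula V -> Prop)
    (Gamma Delta : list (formula V)) (Pi : option (formula V)) :
  ML P Gamma Delta Pi ->
  LL (map (trt P) Gamma)
     (map (fun D => LWhyNot (trt P D)) Delta ++ map (trt P) (stoup_list Pi)).
Proof.
  intros HML. rewrite <- (map_map (trt P) (@LWhyNot V)).
  eapply ll_exch_r; [apply Permutation_app_comm|]. now apply ML_to_LL.
Qed.
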